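(* Let $k\ge 2$ be a fixed integer. Then for all sufficiently large $n$ (depending on $k$) the following holds. Let $x_1,\dots,x_n$ be real numbers with $\sum_{i=1}^n x_i \geq 0$ such that no $x_i$ is large. Then the number $N$ of $k$-element subsets $S\subseteq\{1,\dots,n\}$ with $\sum_{i\in S}x_i\ge 0$ satisfies $N \geq \binom{n-1}{k-1}+\binom{n-k-1}{k-1}-1$.
   Context: A number $x_i$ is called large if for every $(k-1)$-element subset $T\subseteq\{1,\dots,n\}\setminus\{i\}$ we have $x_i+\sum_{j\in T}x_j\ge 0$. *)

(* Defs.v *)
From mathcomp Require Import all_boot all_order all_algebra.
From mathcomp Require Import reals.

Set Implicit Arguments.
Unset Strict Implicit.
Unset Printing Implicit Defensive.

Import Order.TTheory GRing.Theory Num.Theory.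
Local Open Scope ring_scope.

Definition large (R : realType) (k n : nat) (x : 'I_n -> R) (i : 'I_n) : Prop :=
  forall T : {set 'I_n}, T \subset ~: [set i] -> #|T| = (k - 1)%N ->
    0 <= x i + \sum_(j in T) x j.

Definition nonneg_ksets (R : realType) (k n : nat) (x : 'I_n -> R) :
    {set {set 'I_n}} :=
  [set S : {set 'I_n} | (#|S| == k) && (0 <= \sum_(i in S) x i)].

(* Main.v *)
Require Import Defs.
From mathcomp Require Import all_boot all_order all_algebra.
From mathcomp Require Import reals.
From mathcomp Require Import zify lra.

(** Let [p] and [q] be the two largest indices. Removing a negative [k]-set that
    contains the current maximum leaves a nonnegative total, so this removal
    can be repeated, collecting maxima [y_1 >= y_2 >= ...] until the current
    maximum is large among the remaining indices. If it stops after [j] >= 3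
    maxima, each collected maximum forms nonnegative sets with all
    [(k-1)]-subsets of the remaining indices, about [j n^(k-1) / (k-1)!] sets in
    total; if it runs for [J ~ n / (3 k^2)] steps, all the collected maxima are
    nonnegative, which gives ['C(J, k)] sets, of order [n^k]. Both exceed the
    bound. Otherwise all [k]-sets containing [p] and [q] are nonnegative, and
    the families of [T], [U] avoiding [p, q] such that [p |: T] and [q |: U] are
    negative are cross-intersecting and nonempty; the Hilton-Milner type bound
    on the sum of their sizes gives exactly the claimed number. That bound is
    proved for threshold families by induction, removing the element of
    maximal weight. *)

Set Implicit Arguments.
Unset Strict Implicit.
Unset Printing Implicit Defensive.

Import Order.TTheory GRing.Theory Num.Theory.
Local Open Scope ring_scope.

(** * Counting lemmas for finite sets and binomials *)

Lemma card_disjoint_le (T : finType) (A B D : {set T}) :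
  [disjoint A & B] -> A \subset D -> B \subset D -> (#|A| + #|B| <= #|D|)%N.
Proof.
move=> dAB AD BD; rewrite -cardsUI (disjoint_setI0 dAB) cards0 addn0.
by rewrite subset_leq_card // subUset AD.
Qed.

Lemma sum_disjointU (V : nmodType) (I : finType) (A B : {set I}) (F : I -> V) :
  [disjoint A & B] ->
  \sum_(i in A :|: B) F i = \sum_(i in A) F i + \sum_(i in B) F i.
Proof.
move=> dAB; rewrite (big_setID A) /= setUK setDUl setDv set0U (setDidPl _) //.
by rewrite disjoint_sym.
Qed.

Lemma binB (m r : nat) : (1 < m)%N -> (1 < r)%N ->
  'C(m - 1, r - 1) = ('C(m - 2, r - 1) + 'C(m - 2, r - 2))%N.
Proof. by case: m r => [|[|m]] // [|[|r]] // _ _; rewrite !subSS !subn0 binS. Qed.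

Lemma ltn_binS (m r : nat) :
  (0 < r)%N -> (r <= m.+1)%N -> ('C(m, r) < 'C(m.+1, r))%N.
Proof. by case: r => // r _ rm; rewrite binS -addn1 leq_add2l bin_gt0. Qed.

(** * Cross-intersecting threshold families *)

Definition ksubsets (T : finType) (X : {set T}) (r : nat) : {set {set T}} :=
  [set S : {set T} | S \subset X & #|S| == r].

Lemma card_ksubsets (T : finType) (X : {set T}) (r : nat) :
  #|ksubsets X r| = 'C(#|X|, r).
Proof. exact: cards_draws. Qed.

(** The threshold [a] is arbitrary so that the class is closed under links: fixing a member [z]
    turns [a] into [a - x z]. For [p] outside [X] and [a = - x p], these are the [T] for which
    [p |: T] is negative. *)
Definition below (R : realDomainType) (T : finType) (x : T -> R) (X : {set T})
    (r : nat) (a : R) : {set {set T}} :=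
  [set S in ksubsets X r | \sum_(i in S) x i < a].

Lemma belowP (R : realDomainType) (T : finType) (x : T -> R) (X : {set T})
    (r : nat) (a : R) (S : {set T}) :
  reflect [/\ S \subset X, #|S| = r & \sum_(i in S) x i < a]
    (S \in below x X r a).
Proof.
rewrite !inE; apply: (iffP andP) => [[/andP[-> /eqP ->] ->]|[-> -> ->]] //.
by rewrite eqxx.
Qed.

Lemma card_below_le (R : realDomainType) (T : finType) (x : T -> R)
    (X : {set T}) (r : nat) (a : R) (z : T) :
  (#|below x X r.+1 a| <=
   #|below x (X :\ z) r.+1 a| + #|below x (X :\ z) r (a - x z)|)%N.
Proof.
apply: leq_trans (leq_add (leqnn _) (leq_imset_card (setU [set z]) _)).
apply: leq_trans (leq_card_setU _ _).
apply/subset_leq_card/subsetP => S /belowP[SX cS wS].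
have [zS|zS] := boolP (z \in S); rewrite inE; last first.
  by apply/orP; left; apply/belowP; split; rewrite ?subsetD1 ?SX.
apply/orP; right; apply/imsetP; exists (S :\ z); last by rewrite setD1K.
apply/belowP; split; first by rewrite setSD.
  by move: cS; rewrite (cardsD1 z) zS => -[].
by move: wS; rewrite (big_setD1 z) //= ltrBrDl.
Qed.

Lemma card_draws_meeting (T : finType) (X V : {set T}) (r : nat)
    (B : {set {set T}}) :
  V \subset X -> B \subset ksubsets X r ->
  (forall S, S \in B -> ~~ [disjoint V & S]) ->
  (#|B| + 'C(#|X| - #|V|, r) <= 'C(#|X|, r))%N.
Proof.
move=> VX BX meet; rewrite -(card_ksubsets X r).
have -> : (#|X| - #|V| = #|X :\: V|)%N by rewrite cardsD (setIidPr VX).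
rewrite -(card_ksubsets (X :\: V) r).
apply: card_disjoint_le => //.
  rewrite -setI_eq0; apply/eqP/setP => S; rewrite in_setI in_set0.
  apply/negbTE/negP => /andP[/meet /negP SV]; rewrite inE subsetD => /andP[].
  by case/andP => _; rewrite disjoint_sym.
apply/subsetP => S; rewrite !inE => /andP[SX ->].
by rewrite (subset_trans SX) ?subsetDl.
Qed.

(** For [r > 0] equality is attained by a single set together with all [r]-sets meeting it.
    Exchanging the heaviest element [z] for another one keeps a set below its threshold; hence, when
    [2 * r < #|X|], the subfamilies avoiding [z] stay nonempty and the links at [z] still
    cross-intersect. *)
Lemma card_cross_below (R : realDomainType) (T : finType) (x : T -> R)
    (X : {set T}) (r : nat) (a b : R) :
  (2 * r <= #|X|)%N ->
  below x X r a != set0 -> below x X r b != set0 ->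
  (forall S U, S \in below x X r a -> U \in below x X r b ->
    ~~ [disjoint S & U]) ->
  (#|below x X r a| + #|below x X r b| + 'C(#|X| - r, r) <= 'C(#|X|, r) + 1)%N.
Proof.
move Em: #|X| => m; elim: m X r a b Em => [|m IH] X [|r] a b Em rm.
- move=> /set0Pn[S Sa] /set0Pn[U Ub] /(_ _ _ Sa Ub).
  case/belowP: Sa => _ /eqP; rewrite cards_eq0 => /eqP -> _.
  by rewrite -setI_eq0 set0I eqxx.
- by [].
- move=> /set0Pn[S Sa] /set0Pn[U Ub] /(_ _ _ Sa Ub).
  case/belowP: Sa => _ /eqP; rewrite cards_eq0 => /eqP -> _.
  by rewrite -setI_eq0 set0I eqxx.
move=> a0 b0 cross.
have [Er|rm'] : m.+1 = (2 * r.+1)%N \/ (2 * r.+1 <= m)%N by lia.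
  (* When [#|X|] is exactly twice the set size, complements of members of the first family have the
     right size and avoid the second family, and the last binomial equals 1. *)
  rewrite [X in 'C(X - _, _)]Er (_ : 2 * r.+1 - r.+1 = r.+1)%N; last lia.
  rewrite binn leq_add2r -Em -(card_ksubsets X r.+1).
  have inj : {in below x X r.+1 a &, injective (fun S => X :\: S)}.
    move=> S S' /belowP[SX _ _] /belowP[S'X _ _] /(congr1 (setD X)).
    by rewrite !setDDr !setDv !set0U (setIidPr SX) (setIidPr S'X).
  rewrite -(card_in_imset inj).
  set D := [set _ | _ in _].
  apply: card_disjoint_le.
  - rewrite -setI_eq0; apply/eqP/setP => S; rewrite in_setI in_set0.
    apply/negbTE/negP => /andP[/imsetP[S' S'a ->] /(cross _ _ S'a)].
    by rewrite -setI_eq0 setIDA (setIC S') -setIDA setDv setI0 eqxx.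
  - apply/subsetP => _ /imsetP[S /belowP[SX cS _] ->].
    by rewrite inE subsetDl cardsD (setIidPr SX) cS Em Er; apply/eqP; lia.
  - by apply/subsetP => S /belowP[SX cS _]; rewrite inE SX cS eqxx.
have [z0 z0X] : exists z, z \in X by apply/set0Pn; rewrite -card_gt0 Em.
have [z zX zmax] := @arg_maxP _ _ _ z0 (mem X) x z0X.
have {}zX : z \in X by [].
have {}zmax v : v \in X -> x v <= x z by exact: zmax.
have EXz : #|X :\ z| = m by move: Em; rewrite (cardsD1 z) zX => -[].
have shift c S w : S \in below x (X :\ z) r (c - x z) -> w \in X :\ z ->
    w \notin S -> w |: S \in below x (X :\ z) r.+1 c.
  move=> /belowP[SX cS wS] wX wnS; apply/belowP; split.
  - by rewrite subUset sub1set wX.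
  - by rewrite cardsU1 wnS cS.
  - move: wX wS; rewrite big_setU1 //= !inE ltrBrDl => /andP[_ /zmax xwz].
    by apply: le_lt_trans; rewrite lerD2r.
have addz c S : S \in below x (X :\ z) r (c - x z) ->
    z |: S \in below x X r.+1 c.
  move=> /belowP[SX cS wS]; have zS : z \notin S.
    by apply/negP => /(subsetP SX); rewrite !inE eqxx.
  apply/belowP; split.
  - by rewrite subUset sub1set zX (subset_trans SX) ?subsetDl.
  - by rewrite cardsU1 zS cS.
  - by rewrite big_setU1 //= -ltrBrDl.
have widen c S : S \in below x (X :\ z) r.+1 c -> S \in below x X r.+1 c.
  move=> /belowP[SX cS wS]; apply/belowP; split=> //.
  by rewrite (subset_trans SX) ?subsetDl.
have room (S : {set T}) : (#|S| < m)%N -> exists2 w, w \in X :\ z & w \notin S.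
  move=> Sm; have: ~~ (X :\ z \subset S).
    by apply/negP => /subset_leq_card; rewrite EXz leqNgt Sm.
  by case/subsetPn => w; exists w.
have cardS c S : S \in below x (X :\ z) r c -> #|S| = r by case/belowP.
have nonempty c : below x X r.+1 c != set0 -> below x (X :\ z) r.+1 c != set0.
  case/set0Pn => S /belowP[SX cS wS]; apply/set0Pn.
  have [zS|zS] := boolP (z \in S); last first.
    by exists S; apply/belowP; rewrite subsetD1 SX zS.
  have Sz : S :\ z \in below x (X :\ z) r (c - x z).
    apply/belowP; split; first by rewrite setSD.
      by move: cS; rewrite (cardsD1 z) zS => -[].
    by move: wS; rewrite (big_setD1 z) //= ltrBrDl.
  have [|w wX wS'] := room (S :\ z); first by rewrite (cardS _ _ Sz); lia.
  by exists (w |: S :\ z); exact: shift.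
have IH1 := IH _ r.+1 a b EXz rm' (nonempty _ a0) (nonempty _ b0)
  (fun S U Sa Ub => cross S U (widen _ _ Sa) (widen _ _ Ub)).
(* Some member [V] of the first family avoids [z], so it can meet [z |: S] only inside [S]. *)
have meeting c d : below x X r.+1 c != set0 ->
    (forall S U, S \in below x X r.+1 c -> U \in below x X r.+1 d ->
      ~~ [disjoint S & U]) ->
    (#|below x (X :\ z) r (d - x z)| + 'C(m - r.+1, r) <= 'C(m, r))%N.
  move=> /nonempty /set0Pn[V Vc] crossV.
  have [VX cV _] := belowP _ _ _ _ _ Vc.
  rewrite -[X in 'C(X - _, _)]EXz -[X in (_ <= 'C(X, _))%N]EXz -cV.
  apply: card_draws_meeting => //.
    by apply/subsetP => S; rewrite inE => /andP[].
  move=> S Sd; have := crossV _ _ (widen _ _ Vc) (addz _ _ Sd).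
  apply: contra; rewrite -!setI_eq0 setIUr => /eqP ->; rewrite setU0 setI_eq0.
  by rewrite disjoint_sym disjoints1; apply/negP => /(subsetP VX); rewrite !inE eqxx.
have key : (#|below x (X :\ z) r (a - x z)| + #|below x (X :\ z) r (b - x z)|
    + 'C(m - r.+1, r) <= 'C(m, r))%N.
  have [->|az] := eqVneq (below x (X :\ z) r (a - x z)) set0.
    by rewrite cards0 add0n; exact: meeting cross.
  have [->|bz] := eqVneq (below x (X :\ z) r (b - x z)) set0.
    rewrite cards0 addn0; apply: meeting b0 _ => S U Sb Ua.
    by rewrite disjoint_sym; exact: cross.
  have crossz S U : S \in below x (X :\ z) r (a - x z) ->
      U \in below x (X :\ z) r (b - x z) -> ~~ [disjoint S & U].
    (* If [S] and [U] were disjoint, a fresh [w] would make [w |: S] and [z |: U] disjoint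
       members. *)
    move=> Sa Ub; apply/negP => dSU.
    have [|w wX] := room (S :|: U).
      apply: leq_ltn_trans (leq_card_setU _ _) _.
      by rewrite (cardS _ _ Sa) (cardS _ _ Ub) addnn -mul2n (leq_trans _ rm') // ltn_mul2l /=.
    rewrite inE negb_or => /andP[wS wU].
    have := cross _ _ (widen _ _ (shift _ _ _ Sa wX wS)) (addz _ _ Ub).
    move/negP; apply; rewrite -setI_eq0 setIUr !setIUl.
    move: dSU; rewrite -setI_eq0 => /eqP ->; rewrite setU0.
    have /eqP -> : [set w] :&: U == set0 by rewrite setI_eq0 disjoints1.
    have /eqP -> : [set w] :&: [set z] == set0.
      by rewrite setI_eq0 disjoints1 inE; move: wX; rewrite !inE => /andP[].
    have [/subsetP SX _ _] := belowP _ _ _ _ _ Sa.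
    have /eqP -> : S :&: [set z] == set0; last by rewrite !setU0.
    rewrite setI_eq0 disjoint_sym disjoints1.
    by apply/negP => /SX; rewrite !inE eqxx.
  (* For [r > 0], ['C(m - r, r)] exceeds ['C(m - r.+1, r)], which absorbs the [+ 1] of the induction
     hypothesis; for [r = 0] that hypothesis contradicts nonemptiness. *)
  have := IH _ r _ _ EXz ltac:(lia) az bz crossz; rewrite -!card_gt0 in az bz.
  have -> : (m - r = (m - r.+1).+1)%N by lia.
  have [r0|r_gt0] := posnP r.
    by rewrite r0 in az bz *; rewrite !bin0; move: az bz; lia.
  by have := @ltn_binS (m - r.+1) r r_gt0 ltac:(lia); lia.
(* The bounds [IH1] for the deletion and [key] for the link add up by Pascal's rule in each
   binomial. *)
have := card_below_le x X r a z; have := card_below_le x X r b z.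
rewrite subSS (_ : m - r = (m - r.+1).+1)%N; last lia.
by rewrite !binS; lia.
Qed.

(** * Iterated removal of negative sets *)

(* [W] is the union of the negative sets removed so far, [Y] the maxima
   collected from them; the induction is on the number [J - #|Y|] of steps
   left. *)
Lemma card_nonneg_ksets_cascade (R : realType) (k n J M : nat)
    (x : 'I_n -> R) :
  (0 < k)%N -> (k * J < n)%N -> (M <= 'C(J, k))%N ->
  (M <= 3 * 'C(n - k * J - 1, k - 1))%N ->
  forall W Y : {set 'I_n}, Y \subset W -> (2 <= #|Y| <= J)%N ->
  (#|W| <= k * #|Y|)%N -> 0 <= \sum_(i in ~: W) x i ->
  (forall y v, y \in Y -> v \notin W -> x v <= x y) ->
  (M <= #|nonneg_ksets k x|)%N.
Proof.
move=> k0 kJn MJ M3 W Y; move Ed: (J - #|Y|)%N => d.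
elim: d W Y Ed => [|d IH] W Y Ed YW /andP[Y2 YJ] cW sW top.
all: have Wn : (#|W| < n)%N by apply: leq_ltn_trans cW _; nia.
all: have cWC : #|~: W| = (n - #|W|)%N by rewrite cardsCs setCK card_ord.
all: have [z0 z0W] : exists z, z \in ~: W by apply/set0Pn; rewrite -card_gt0; lia.
all: have [z zW zmax] := @arg_maxP _ _ _ z0 (mem (~: W)) x z0W.
all: have {}zW : z \in ~: W by [].
all: have {}zmax v : v \in ~: W -> x v <= x z by exact: zmax.
  (* No steps are left. The nonnegative total forces the maximum outside [W], hence all of [Y], to
     be nonnegative. *)
  have EJ : #|Y| = J by lia.
  have z_ge0 : 0 <= x z.
    rewrite leNgt; apply/negP => z_lt0; move: sW; apply/negP; rewrite -ltNge.
    rewrite (bigD1 z) //= ltr_wnDr // sumr_le0 // => i /andP[iW _].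
    by rewrite (le_trans (zmax _ iW)) // ltW.
  apply: leq_trans MJ _; rewrite -EJ -(card_ksubsets Y k).
  apply/subset_leq_card/subsetP => S; rewrite !inE => /andP[/subsetP SY ->] /=.
  apply: sumr_ge0 => i /SY iY; apply: le_trans z_ge0 _.
  by apply: top => //; move: zW; rewrite inE.
have znW : z \notin W by move: zW; rewrite inE.
have znY : z \notin Y by apply: contra znW; exact/subsetP.
have [/existsP[U /andP[UD sU]]|] := boolP [exists U,
    (U \in ksubsets (~: W :\ z) (k - 1)) && (x z + \sum_(i in U) x i < 0)].
  move: UD; rewrite inE subsetD1 => /andP[/andP[UW zU] /eqP cU].
  have UWz : z |: U \subset ~: W by rewrite subUset sub1set zW.
  have cY : #|z |: Y| = #|Y|.+1 by rewrite cardsU1 znY.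
  apply: (IH (z |: U :|: W) (z |: Y)); rewrite ?cY.
  - by rewrite subnS Ed.
  - by rewrite -setUA setUS // setUC subsetU // YW.
  - by rewrite (leqW Y2) -subn_gt0 Ed.
  - apply: leq_trans (leq_card_setU _ _) _.
    by rewrite mulnS leq_add // cardsU1 zU cU (subnKC k0).
  - move: sW; rewrite (big_setID (z |: U)) /= (setIidPr UWz) big_setU1 //=.
    by rewrite setCU setDE setIC; lra.
  - move=> y v; rewrite !inE !negb_or => /orP[/eqP ->|yY] /andP[_ vW].
      by apply: zmax; rewrite inE.
    exact: top.
(* Now [z] is large among the remaining indices, and every [y] in [Y] weighs at least as much, so
   each element of [z |: Y] can be joined to every [U]. *)
rewrite negb_exists => /forallP all_ge0.
have {all_ge0} ext y U : y \in z |: Y -> U \in ksubsets (~: W :\ z) (k - 1) ->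
    0 <= x y + \sum_(i in U) x i.
  move=> yY UD; have := all_ge0 U; rewrite UD -leNgt => h.
  apply: le_trans h _; rewrite lerD2r; move: yY; rewrite !inE.
  by case/orP => [/eqP ->//|yY]; exact: top.
have disj y U : U \in ksubsets (~: W :\ z) (k - 1) -> y \in z |: Y -> y \notin U.
  rewrite inE => /andP[/subsetP UW _] yY; apply/negP => /UW.
  rewrite !inE => /andP[yz yW]; move: yY; rewrite !inE (negbTE yz) /=.
  by move/(subsetP YW); rewrite (negbTE yW).
pose f (p : 'I_n * {set 'I_n}) := p.1 |: p.2.
pose P := setX (z |: Y) (ksubsets (~: W :\ z) (k - 1)).
have f_inj : {in P &, injective f}.
  move=> [y U] [y' U'] /setXP[/= yY UD] /setXP[/= y'Y U'D]; rewrite /f /= => E.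
  have yy' : y = y'.
    have : y \in y' |: U' by rewrite -E setU11.
    by rewrite !inE => /orP[/eqP//|]; rewrite (negbTE (disj _ _ U'D yY)).
  subst y'; congr pair; apply/setP => i; move/setP/(_ i): E; rewrite !inE.
  have [->|//] := eqVneq i y.
  by rewrite (negbTE (disj _ _ UD yY)) (negbTE (disj _ _ U'D yY)).
apply: leq_trans (_ : #|f @: P| <= _)%N; last first.
  apply/subset_leq_card/subsetP => _ /imsetP[[y U] /setXP[/= yY UD] ->].
  have yU := disj _ _ UD yY.
  rewrite inE /f /= big_setU1 //= ext // cardsU1 yU andbT.
  by move: UD; rewrite inE => /andP[_ /eqP ->]; exact/eqP/(subnKC k0).
(* The factor 3 counts [z] and at least two elements of [Y]. *)
rewrite (card_in_imset f_inj) cardsX card_ksubsets cardsU1 znY.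
apply: leq_trans M3 _; apply: leq_mul; first by lia.
apply: leq_bin2l; have : #|~: W| = #|~: W :\ z|.+1 by rewrite (cardsD1 z) zW.
have : (#|W| <= k * J)%N by apply: leq_trans cW _; rewrite leq_mul2l YJ orbT.
by rewrite cWC; lia.
Qed.

(** * Choice of the number of steps [J] *)

Lemma leq_exp_ffact (q k : nat) : (q ^ k <= (q + k) ^_ k)%N.
Proof.
elim: k => // k IH; rewrite addnS ffactSS expnS; apply: leq_mul => //.
by rewrite -addnS leq_addr.
Qed.

Lemma leq_ffact_exp (m r : nat) : (m ^_ r <= m ^ r)%N.
Proof.
by elim: r => // r IH; rewrite ffactnSr expnSr; apply: leq_mul; rewrite ?leq_subr.
Qed.

(** Pascal's rule applied [d] times, each loss being bounded by the first and largest one. *)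
Lemma leq_bin_sub (N d r : nat) :
  ('C(N, r.+1) <= 'C(N - d, r.+1) + d * 'C(N.-1, r))%N.
Proof.
elim: d => [|d IH]; first by rewrite subn0 leq_addr.
apply: leq_trans IH _; rewrite mulSn addnA leq_add2r subnS.
case E: (N - d)%N => [|p] //=.
by rewrite binS leq_add2l; apply: leq_bin2l; lia.
Qed.

(** The number to be reached is at most [2 * 'C(n - 1, k - 1)]. With [J] about [n / (3 * k ^ 2)],
    ['C(J, k)] has one more power of [n], while discarding [k * J] indices loses at most a third of
    ['C(n - 1, k - 1)]. *)
Lemma cascade_length (k : nat) : (2 <= k)%N ->
  exists n0, forall n, (n0 <= n)%N -> exists J,
    [/\ (2 <= J)%N, (k * J < n)%N, (2 * k <= n)%N,
        (2 * 'C(n - 1, k - 1) <= 'C(J, k))%N &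
        (2 * 'C(n - 1, k - 1) <= 3 * 'C(n - k * J - 1, k - 1))%N].
Proof.
(* [A] comes from [n - 1 < B * J.+1 <= A * (J - k)]; [q0], a lower bound for [J - k], absorbs the
   factorial and the power of [A] in the estimates. *)
move=> k2; pose B := (3 * k ^ 2)%N; pose A := (B * (k + 2))%N.
pose q0 := (2 * k`! * A ^ (k - 1) + 1)%N.
exists (B * (k + q0) + 1)%N => n n0n; pose J := ((n - 1) %/ B)%N; exists J.
have B0 : (0 < B)%N by rewrite muln_gt0 expn_gt0; lia.
have BJ : (B * J <= n - 1)%N by rewrite mulnC leq_trunc_div.
have BJS : (n - 1 < B * J.+1)%N by rewrite mulnC ltn_ceil.
have Jq : (k + q0 <= J)%N by rewrite leq_divRL // mulnC; lia.
have kB : (k * (3 * k) = B)%N by rewrite /B; nia.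
have q0_gt0 : (0 < q0)%N by rewrite /q0; lia.
split; [lia|nia|nia| |].
- pose q := (J - k)%N; have EJ : J = (q + k)%N by rewrite /q; lia.
  have q0q : (q0 <= q)%N by rewrite /q; lia.
  have nA : (n - 1 <= A * q)%N.
    apply: leq_trans (ltnW BJS) _; rewrite /A -mulnA leq_mul2l; apply/orP; right.
    by rewrite EJ; nia.
  rewrite -(leq_pmul2r (fact_gt0 k)) bin_ffact EJ.
  apply: leq_trans (leq_exp_ffact q k).
  have -> : (q ^ k = q * q ^ (k - 1))%N by rewrite -expnS; congr expn; lia.
  apply: (@leq_trans (q0 * q ^ (k - 1))%N); last by rewrite leq_mul2r q0q orbT.
  have : ('C(n - 1, k - 1) <= A ^ (k - 1) * q ^ (k - 1))%N.
    rewrite -expnMn; apply: leq_trans (_ : (n - 1) ^ (k - 1) <= _)%N.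
      apply: leq_trans (leq_ffact_exp _ _); rewrite -bin_ffact.
      by rewrite leq_pmulr // fact_gt0.
    by rewrite leq_exp2r //; lia.
  move=> h.
  apply: (@leq_trans (2 * (A ^ (k - 1) * q ^ (k - 1)) * k`!)%N).
    by rewrite leq_mul // leq_mul.
  rewrite /q0 mulnDl mul1n; apply: leq_trans (leq_addr _ _); apply/eq_leq.
  by rewrite -!mulnA; congr muln; rewrite mulnA mulnC.
- have -> : (n - k * J - 1 = n - 1 - k * J)%N by lia.
  have [r Er] : exists r, (k - 1 = r.+1)%N by exists (k - 2)%N; lia.
  rewrite Er; have h := leq_bin_sub (n - 1) (k * J) r.
  have E := mul_bin_diag (n - 1) r.
  set a := 'C(_, _) in h E *; set b := 'C(_, _) in h E *; set c := 'C(_, _) in h E *.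
  have n1 : (0 < n - 1)%N by lia.
  (* Multiplying by [n - 1] turns the loss [k * J * c] into [k * J * (r.+1 * a)], at most a third of
     [(n - 1) * a]. *)
  rewrite -(leq_pmul2l n1).
  have : (3 * (k * J * r.+1) <= n - 1)%N.
    apply: leq_trans BJ; rewrite /B expnS expn1 -!mulnA leq_mul2l /=.
    by rewrite leq_mul2l mulnC leq_mul2r; apply/orP; right; lia.
  move=> D.
  have {}h : ((n - 1) * a <= (n - 1) * b + k * J * (r.+1 * a))%N.
    by rewrite -E mulnCA -mulnDr leq_mul2l h orbT.
  have {}D : (3 * (k * J * r.+1) * a <= (n - 1) * a)%N by rewrite leq_mul2r D orbT.
  by lia.
Qed.

(** * Counting by the trace on the two largest indices *)

(** Each singleton trace on [[set p; q]] gives ['C(n - 2, k - 1)] sets minus a family [below], and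
    the full trace gives all ['C(n - 2, k - 2)]; sets with empty trace are discarded. *)
Lemma card_nonneg_ksets_pair (R : realType) (k n : nat) (x : 'I_n -> R)
    (p q : 'I_n) :
  (2 <= k)%N -> q != p ->
  (forall V, V \in ksubsets (~: [set p; q]) (k - 2) ->
    0 <= x p + x q + \sum_(i in V) x i) ->
  (2 * 'C(n - 2, k - 1) + 'C(n - 2, k - 2) <= #|nonneg_ksets k x| +
    #|below x (~: [set p; q]) (k - 1) (- x p)%R| +
    #|below x (~: [set p; q]) (k - 1) (- x q)%R|)%N.
Proof.
move=> hk qp; set Y := [set p; q]; set X := ~: Y => pq_ge0.
have cY : #|Y| = 2%N by rewrite cards2 eq_sym qp.
have cX : #|X| = (n - 2)%N by rewrite cardsCs setCK card_ord cY.
have YX (S : {set 'I_n}) : S \subset X -> [disjoint Y & S].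
  by move=> SX; rewrite disjoint_sym disjoints_subset.
have pX (S : {set 'I_n}) : S \subset X -> p \notin S.
  by move=> SX; apply/negP => /(subsetP SX); rewrite !inE eqxx.
have qX (S : {set 'I_n}) : S \subset X -> q \notin S.
  by move=> SX; apply/negP => /(subsetP SX); rewrite !inE eqxx orbT.
pose NN := nonneg_ksets k x.
have count_one y a : y \in Y -> a = - x y ->
    ('C(#|X|, k - 1) <= #|[set S in NN | S :&: Y == [set y]]| +
       #|below x X (k - 1) a|)%N.
  move=> yY Ea; rewrite -(card_ksubsets X (k - 1)%N).
  have yX S : S \in ksubsets X (k - 1) -> y \notin S.
    by rewrite inE => /andP[SX _]; move: yY; rewrite !inE => /orP[] /eqP ->;
      [exact: pX|exact: qX].
  rewrite addnC -leq_subLR.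
  have -> : (#|ksubsets X (k - 1)| - #|below x X (k - 1) a| =
      #|ksubsets X (k - 1) :\: below x X (k - 1) a|)%N.
    by rewrite cardsD (setIidPr _) //; apply/subsetP => S; rewrite inE => /andP[].
  rewrite -(card_in_imset (f := setU [set y])); last first.
    move=> S S' /setDP[SD _] /setDP[S'D _] /(congr1 (fun A => A :\ y)).
    by rewrite !setU1K ?yX.
  apply/subset_leq_card/subsetP => _ /imsetP[S /setDP[SD SB] ->].
  have yS := yX _ SD; move: (SD); rewrite inE => /andP[SX /eqP cS].
  rewrite !inE cardsU1 yS cS big_setU1 //= setIUl.
  have -> : S :&: Y = set0 by apply/eqP; rewrite setI_eq0 disjoint_sym YX.
  rewrite setU0 (setIidPl _) ?sub1set // eqxx andbT; apply/andP; split.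
    exact/eqP/(subnKC (ltnW hk)).
  rewrite leNgt; apply: contra SB => sS; apply/belowP; split=> //.
  by rewrite Ea; move: sS; lra.
have count_two : ('C(#|X|, k - 2) <= #|[set S in NN | S :&: Y == Y]|)%N.
  rewrite -(card_ksubsets X (k - 2)%N).
  rewrite -(card_in_imset (f := setU Y)); last first.
    move=> S S'; rewrite !inE => /andP[SX _] /andP[S'X _] /(congr1 (fun A => A :\: Y)).
    by rewrite /= (setDUl _ S) (setDUl _ S') setDv !set0U !(setDidPl _) // disjoint_sym YX.
  apply/subset_leq_card/subsetP => _ /imsetP[S SD ->].
  have sS := pq_ge0 _ SD; move: SD; rewrite inE => /andP[SX /eqP cS].
  rewrite !inE setUK eqxx andbT (sum_disjointU _ (YX _ SX)) //=.
  rewrite big_setU1 ?inE 1?eq_sym //= big_set1 sS andbT.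
  rewrite cardsU (disjoint_setI0 (YX _ SX)) cards0 subn0 cY cS.
  by rewrite subnKC.
have := count_one p _ _ erefl; have := count_one q _ _ erefl.
rewrite !inE !eqxx orbT => /(_ isT) cq /(_ isT) cp.
have total : (#|[set S in NN | S :&: Y == [set p]]| +
  #|[set S in NN | S :&: Y == [set q]]| + #|[set S in NN | S :&: Y == Y]| <= #|NN|)%N.
  have sub (A : {set 'I_n}) : [set S in NN | S :&: Y == A] \subset NN.
    by apply/subsetP => S; rewrite inE => /andP[].
  have disj (A B : {set 'I_n}) : A != B ->
      [disjoint [set S in NN | S :&: Y == A] & [set S in NN | S :&: Y == B]].
    move=> AB; rewrite -setI_eq0; apply/eqP/setP => S; rewrite !inE.
    by apply/negbTE/negP => /andP[/andP[_ /eqP ->] /andP[_]]; apply/negP.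
  have pq : [set p] != [set q] by rewrite (inj_eq set1_inj) eq_sym.
  have pY : [set p] != Y.
    by apply/eqP => /(congr1 (fun A : {set _} => #|A|)); rewrite cards1 cY.
  have qY : [set q] != Y.
    by apply/eqP => /(congr1 (fun A : {set _} => #|A|)); rewrite cards1 cY.
  have dU : [disjoint [set S in NN | S :&: Y == [set p]] :|:
      [set S in NN | S :&: Y == [set q]] & [set S in NN | S :&: Y == Y]].
    by rewrite -setI_eq0 setIUl setU_eq0 !setI_eq0 !disj.
  apply: leq_trans (card_disjoint_le dU _ (sub Y)); last by rewrite subUset !sub.
  by rewrite leq_add2r card_disjoint_le ?disj ?subsetUl ?subsetUr.
move: cq cp count_two total; rewrite cX.
move: #|NN| #|[set S in NN | S :&: Y == [set p]]|.
move: #|[set S in NN | S :&: Y == [set q]]| #|[set S in NN | S :&: Y == Y]|.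
move: #|below x X (k - 1) (- x p)| #|below x X (k - 1) (- x q)|.
by clear; lia.
Qed.

Theorem theorem1p3 (k : nat) (hk : (2 <= k)%N) :
  exists n0 : nat, forall n : nat, (n0 <= n)%N ->
  forall (R : realType) (x : 'I_n -> R),
    0 <= \sum_(i < n) x i ->
    (forall i : 'I_n, ~ large k x i) ->
    ('C(n - 1, k - 1) + 'C(n - k - 1, k - 1) - 1 <= #|nonneg_ksets k x|)%N.
Proof.
have [n0 len] := cascade_length hk; exists n0 => n /len {len n0}.
move=> [J [J2 kJn k2n MJ M3]] R x sum_ge0 notlarge.
have pascal := @binB n k ltac:(lia) hk.
have nk : (n - k - 1 = n - 2 - (k - 1))%N by lia.
have n_gt0 : (0 < n)%N by lia.
have [p _ pmax] := @arg_maxP _ _ _ (Ordinal n_gt0) xpredT x isT.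
have {}pmax v : x v <= x p by exact: pmax.
have [q0 q0p] : exists q, q != p.
  have /set0Pn[q] : [set~ p] != set0 by rewrite -card_gt0 cardsC1 card_ord; lia.
  by rewrite !inE; exists q.
have [q qp qmax] := @arg_maxP _ _ _ q0 (fun v => v != p) x q0p.
have {}qmax v : v != p -> x v <= x q by exact: qmax.
pose Y := [set p; q]; pose X := ~: Y.
have cY : #|Y| = 2%N by rewrite cards2 eq_sym qp.
have cX : #|X| = (n - 2)%N by rewrite cardsCs setCK card_ord cY.
have YX (S : {set 'I_n}) : S \subset X -> [disjoint Y & S].
  by move=> SX; rewrite disjoint_sym disjoints_subset.
(* The cascade starts with [Y = [set p; q]] and [W = Y :|: V], where [#|W| <= 2 * k]. This covers
   one negative [k]-set containing [p] and [q] as well as two disjoint ones containing one each. *)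
have cascade (V : {set 'I_n}) : V \subset X -> (#|V| <= 2 * (k - 1))%N ->
    x p + x q + \sum_(i in V) x i < 0 ->
    ('C(n - 1, k - 1) + 'C(n - k - 1, k - 1) - 1 <= #|nonneg_ksets k x|)%N.
  move=> VX cV sV.
  have M2 : ('C(n - 1, k - 1) + 'C(n - k - 1, k - 1) - 1 <=
      2 * 'C(n - 1, k - 1))%N.
    have : ('C(n - k - 1, k - 1) <= 'C(n - 1, k - 1))%N by apply: leq_bin2l; lia.
    by lia.
  apply: (card_nonneg_ksets_cascade _ kJn (leq_trans M2 MJ) (leq_trans M2 M3)
    (W := Y :|: V) (Y := Y)).
  - by lia.
  - exact: subsetUl.
  - by rewrite cY J2.
  - by apply: leq_trans (leq_card_setU _ _) _; rewrite cY; lia.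
  - move: sum_ge0; rewrite (bigID (mem (Y :|: V))) /=.
    rewrite (sum_disjointU _ (YX _ VX)) //= big_setU1 ?inE 1?eq_sym //= big_set1.
    under [X in _ + X]eq_bigl do rewrite -in_setC.
    by move: sV; lra.
  - move=> y v; rewrite !inE !negb_or => /orP[/eqP -> //|/eqP ->].
    by case/andP => /andP[vp _] _; exact: qmax.
have [/existsP[V /andP[VD sV]]|] := boolP [exists V,
    (V \in ksubsets X (k - 2)) && (x p + x q + \sum_(i in V) x i < 0)].
  by move: VD; rewrite inE => /andP[VX /eqP cV]; apply: (cascade V); rewrite ?cV //; lia.
rewrite negb_exists => /forallP pq_ge0.
have {}pq_ge0 V : V \in ksubsets X (k - 2) -> 0 <= x p + x q + \sum_(i in V) x i.
  by move=> VD; have := pq_ge0 V; rewrite VD -leNgt.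
pose F := below x X (k - 1) (- x p); pose G := below x X (k - 1) (- x q).
have [/existsP[S /andP[SF /existsP[U /andP[UG dSU]]]]|] := boolP [exists S,
    (S \in F) && [exists U, (U \in G) && [disjoint S & U]]].
  have [SX cS sS] := belowP _ _ _ _ _ SF.
  have [UX cU sU] := belowP _ _ _ _ _ UG.
  apply: (cascade (S :|: U)); first by rewrite subUset SX.
    by apply: leq_trans (leq_card_setU _ _) _; rewrite cS cU addnn -mul2n.
  by rewrite (sum_disjointU _ dSU) //=; move: sS sU; lra.
rewrite negb_exists => /forallP cross.
have {}cross S U : S \in F -> U \in G -> ~~ [disjoint S & U].
  move=> SF UG; have := cross S; rewrite SF negb_exists => /forallP /(_ U).
  by rewrite UG.
have FG : F \subset G.
  apply/subsetP => S /belowP[SX cS sS]; apply/belowP; split=> //.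
  by apply: lt_le_trans sS _; rewrite lerN2.
(* A set [T] witnessing that [p] is not large avoids [q], since [k]-sets containing both are
   nonnegative; hence it lies in [F]. *)
have F0 : F != set0.
  have [/existsP[T /and3P[TD cT sT]]|] := boolP [exists T : {set 'I_n},
      [&& T \subset ~: [set p], #|T| == (k - 1)%N & x p + \sum_(j in T) x j < 0]].
    have {}sT : x p + \sum_(j in T) x j < 0 by [].
    have pT : p \notin T by apply/negP => /(subsetP TD); rewrite !inE eqxx.
    have [qT|qT] := boolP (q \in T).
      move: sT; rewrite (big_setD1 q) //= ltNge => /negP[].
      rewrite addrA; apply: pq_ge0; rewrite inE; apply/andP; split.
        rewrite /X setCU -setDE; apply: setSD.
        by rewrite -disjoints_subset disjoint_sym disjoints1.
      by move: cT; rewrite (cardsD1 q T) qT => /eqP; lia.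
    apply/set0Pn; exists T; apply/belowP; split; last by move: sT; lra.
      by rewrite /X setCU subsetI -!disjoints_subset ![[disjoint T & _]]disjoint_sym
        !disjoints1 pT qT.
    exact/eqP.
  rewrite negb_exists => /forallP all_ge0; case: (notlarge p) => T TD cT.
  by have := all_ge0 T; rewrite TD cT eqxx /= -leNgt.
have G0 : G != set0.
  by case/set0Pn: F0 => S /(subsetP FG) SG; apply/set0Pn; exists S.
have bound : (#|F| + #|G| + 'C(#|X| - (k - 1), k - 1) <= 'C(#|X|, k - 1) + 1)%N.
  by apply: card_cross_below => //; rewrite cX; lia.
(* Using [bound] leaves at least ['C(n - 2, k - 1) + 'C(n - 2, k - 2) + 'C(n - k - 1, k - 1) - 1]
   sets, and Pascal's rule merges the first two terms. *)
have := card_nonneg_ksets_pair hk qp pq_ge0.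
rewrite -/Y -/X -/F -/G; move: bound; rewrite cX -nk pascal.
by move: #|F| #|G| #|nonneg_ksets k x|; clear; lia.
Qed.
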